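(* Let $K$ be a field with $\operatorname{char}K\neq 2$, let $Q(x)=x_1^2+\cdots+x_d^2$ on $K^d$, and let $S=\{s_1,\ldots,s_m\}\subset K^d$ (with $m=|S|$) be a two-distance set with two distinct nonzero squared distances $\alpha,\beta\in K$. Let $$H=\begin{pmatrix}1&1&\cdots&1\\ s_{1,1}&s_{2,1}&\cdots&s_{m,1}\\ \vdots&\vdots&&\vdots\\ s_{1,d}&s_{2,d}&\cdots&s_{m,d}\end{pmatrix}\in K^{(d+1)\times m},$$ where $s_{i,k}$ denotes the $k$-th coordinate of $s_i$, and let $\widehat H\in K^{(d+2)\times m}$ be obtained from $H$ by adjoining the row $(Q(s_1),Q(s_2),\ldots,Q(s_m))$. Then $$|S|\le\binom{d+2}{2}-1+\operatorname{rank}\widehat H-\operatorname{rank}(H\widehat H^T).$$ In particular, $$|S|\le\binom{d+2}{2}+\operatorname{rank}H-\operatorname{rank}(HH^T).$$ Consequently, $|S|\le\binom{d+2}{2}+d+1-\operatorname{rank}(HH^T)$.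
   Context: A set $S\subset K^d$ is a two-distance set with squared distances $\alpha\ne\beta$ if the set of values $Q(x-y)$, over distinct $x,y\in S$, is exactly $\{\alpha,\beta\}$. All ranks are over $K$. *)

(* Defs.v *)
From HB Require Import structures.
From mathcomp Require Import all_boot all_order all_algebra.

Set Implicit Arguments.
Unset Strict Implicit.
Unset Printing Implicit Defensive.

Import GRing.Theory.
Local Open Scope ring_scope.

Definition sqform (K : fieldType) (d : nat) (x : 'rV[K]_d) : K :=
  \sum_(k < d) x 0 k ^+ 2.

Definition two_distance_set (K : fieldType) (d : nat)
    (S : {pred 'rV[K]_d}) (alpha beta : K) : Prop :=
  alpha != beta /\
  forall c : K,
    (exists x y : 'rV[K]_d,
        [/\ x \in S, y \in S, x != y & c = sqform (x - y)])
    <-> (c = alpha \/ c = beta).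

(* The points are the columns: the k-th coordinate of the i-th point sits in
   row k.+1 and column i, below the row of ones. *)
Definition Hmx (K : fieldType) (d m : nat) (s : m.-tuple 'rV[K]_d) :
    'M[K]_(1 + d, m) :=
  col_mx (const_mx 1) (\matrix_(k < d, i < m) tnth s i 0 k).

Definition Hhatmx (K : fieldType) (d m : nat) (s : m.-tuple 'rV[K]_d) :
    'M[K]_(1 + d + 1, m) :=
  col_mx (Hmx s) (\row_(i < m) sqform (tnth s i)).

(* Main.v *)
(* Let U be the space of vectors u with sum_i u_i p(s_i) = 0 for all polynomials
   p of degree at most 2, so dim U >= m - C(d+2,2).  The annihilating
   polynomials f_j(x) = (Q(x - s_j) - alpha)(Q(x - s_j) - beta) satisfy
   f_j(s_i) = alpha beta delta_ij, and modulo degree 2 they are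
   Q(x)^2 - 4 Q(x) <x, s_j>.  Pairing them with u in U expresses alpha beta u_j
   as an affine function of s_j.  Hence U lies in the row space of H, and it is
   orthogonal to the rows of Hhat, so dim U <= rank H - rank (H Hhat^T).  If
   rank Hhat = rank H, then Q agrees on S with an affine function, so the space
   of restrictions to S of polynomials of degree at most 2 has dimension less
   than C(d+2,2), which gains the missing 1. *)
Require Import Defs.
From HB Require Import structures.
From mathcomp Require Import all_boot all_order all_algebra.
From mathcomp Require Import ring zify.

Set Implicit Arguments.
Unset Strict Implicit.
Unset Printing Implicit Defensive.

Import Order.TTheory GRing.Theory Num.Theory.
Local Open Scope ring_scope.

Section TwoDistance.

Variables (K : fieldType) (d m : nat).
Implicit Types (x y : 'rV[K]_d) (s : m.-tuple 'rV[K]_d).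

Definition dot x y : K := \sum_(k < d) x 0 k * y 0 k.

Lemma sqformB x y : sqform (x - y) = sqform x - 2 * dot x y + sqform y.
Proof.
rewrite /sqform /dot mulr_sumr -sumrB -big_split /=.
by apply: eq_bigr => k _; rewrite !mxE; ring.
Qed.

Lemma sqform0 : sqform (0 : 'rV[K]_d) = 0.
Proof. by rewrite /sqform big1 // => k _; rewrite mxE expr0n. Qed.

Local Notation le_pair := {p : 'I_(1 + d) * 'I_(1 + d) | (p.1 <= p.2)%N}.

(** Ordering the pair lists each monomial of degree at most 2 exactly once. The larger entry [j]
    leaves [j.+1] choices for the smaller one, and these counts sum to the binomial. *)
Lemma card_le_pair : #|{: le_pair}| = 'C(d + 2, 2).
Proof.
rewrite card_sig -sum1_card.
rewrite (eq_bigl (fun p : 'I_(1 + d) * 'I_(1 + d) => true && (p.1 <= p.2)%N)) //.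
rewrite -(pair_big_dep xpredT (fun i j : 'I_(1 + d) => (i <= j)%N) (fun _ _ => 1%N)) /=.
rewrite (exchange_big_dep xpredT) //=.
rewrite addn2 -bin2_sum big_nat_recl // add0n big_mkord.
apply: eq_bigr => j _; rewrite sum1_card.
rewrite -[RHS](card_ord j.+1).
have ltj (i : 'I_j.+1) : (i < 1 + d)%N by apply: leq_trans (ltn_ord i) (ltn_ord j).
rewrite -(card_codom (f := fun i : 'I_j.+1 => Ordinal (ltj i))); last first.
  by move=> i i' [] /val_inj.
apply: eq_card => i; rewrite unfold_in /=.
apply/idP/codomP => [le_ij | [i' ->]]; last exact: (ltn_ord i').
by exists (Ordinal (le_ij : (i < j.+1)%N)); apply: val_inj.
Qed.

(* The rows are the monomials of degree at most 2, written as products of two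
   of the homogeneous coordinates (1, x_1, ..., x_d). *)
Definition quadmx s : 'M[K]_(#|{: le_pair}|, m) :=
  \matrix_(t, i) (Hmx s (val (enum_val t)).1 i * Hmx s (val (enum_val t)).2 i).

Lemma Hmx0 s i : Hmx s (lshift d 0) i = 1.
Proof. by rewrite col_mxEu mxE. Qed.

Lemma HmxS s k i : Hmx s (rshift 1 k) i = tnth s i 0 k.
Proof. by rewrite col_mxEd mxE. Qed.

Section Annihilator.

Variables (s : m.-tuple 'rV[K]_d) (u : 'rV[K]_m).
Hypothesis uP : u *m (quadmx s)^T = 0.

Lemma ann_quad a b : \sum_i u 0 i * (Hmx s a i * Hmx s b i) = 0.
Proof.
wlog le_ab : a b / (a <= b)%N.
  move=> IH; case/orP: (leq_total a b) => [/IH // | /IH sum0].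
  by rewrite -[RHS]sum0; apply: eq_bigr => i _; rewrite (mulrC (Hmx s a i)).
pose t : le_pair := exist _ (a, b) le_ab.
have /matrixP/(_ 0 (enum_rank t)) := uP.
by rewrite !mxE => sum0; rewrite -[RHS]sum0; apply: eq_bigr => i _; rewrite !mxE enum_rankK.
Qed.

Lemma ann_const : \sum_i u 0 i = 0.
Proof.
rewrite -[RHS](ann_quad (lshift d 0) (lshift d 0)).
by apply: eq_bigr => i _; rewrite Hmx0 !mulr1.
Qed.

Lemma ann_coord k : \sum_i u 0 i * tnth s i 0 k = 0.
Proof.
rewrite -[RHS](ann_quad (lshift d 0) (rshift 1 k)).
by apply: eq_bigr => i _; rewrite Hmx0 HmxS mul1r.
Qed.

Lemma ann_coord2 k l : \sum_i u 0 i * (tnth s i 0 k * tnth s i 0 l) = 0.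
Proof.
rewrite -[RHS](ann_quad (rshift 1 k) (rshift 1 l)).
by apply: eq_bigr => i _; rewrite !HmxS.
Qed.

Lemma ann_sqform : \sum_i u 0 i * sqform (tnth s i) = 0.
Proof.
under eq_bigr do rewrite mulr_sumr.
by rewrite exchange_big big1 // => k _; rewrite -[RHS](ann_coord2 k k).
Qed.

Lemma ann_dot y : \sum_i u 0 i * dot (tnth s i) y = 0.
Proof.
under eq_bigr do rewrite mulr_sumr.
rewrite exchange_big big1 // => k _.
by under eq_bigr do rewrite mulrA; rewrite -mulr_suml ann_coord mul0r.
Qed.

Lemma ann_dot2 y : \sum_i u 0 i * dot (tnth s i) y ^+ 2 = 0.
Proof.
under eq_bigr => i _ do rewrite expr2 {1}/dot mulr_suml mulr_sumr.
rewrite exchange_big big1 //= => k _.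
under eq_bigr => i _ do rewrite mulr_sumr mulr_sumr.
rewrite exchange_big big1 //= => l _.
transitivity (y 0 k * y 0 l * \sum_i u 0 i * (tnth s i 0 k * tnth s i 0 l)).
  rewrite mulr_sumr; apply: eq_bigr => i _; ring.
by rewrite ann_coord2 mulr0.
Qed.

Lemma ann_quartic (alpha beta : K) y :
  \sum_i u 0 i * ((sqform (tnth s i - y) - alpha) * (sqform (tnth s i - y) - beta))
  = \sum_i u 0 i * sqform (tnth s i) ^+ 2
    - 4 * \sum_i u 0 i * sqform (tnth s i) * dot (tnth s i) y.
Proof.
(* [c] is the coefficient of Q(x) - 2<x, y> in the expanded product. Only Q(x)^2 and Q(x)<x, y> have
   degree above 2, so [u] kills all the rest. *)
set q := sqform y; pose c := 2 * q - alpha - beta.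
transitivity (\sum_i u 0 i * sqform (tnth s i) ^+ 2
    - 4 * \sum_i u 0 i * sqform (tnth s i) * dot (tnth s i) y
    + 4 * \sum_i u 0 i * dot (tnth s i) y ^+ 2
    + c * \sum_i u 0 i * sqform (tnth s i)
    - 2 * c * \sum_i u 0 i * dot (tnth s i) y
    + (q - alpha) * (q - beta) * \sum_i u 0 i); last first.
  by rewrite ann_dot2 ann_sqform ann_dot ann_const; ring.
rewrite !mulr_sumr -!(sumrB, big_split) /=.
by apply: eq_bigr => i _; rewrite sqformB -/q /c; ring.
Qed.

Lemma ann_Hhatmx : u *m (Hhatmx s)^T = 0.
Proof.
apply/rowP => j; rewrite !mxE.
case: (split_ordP j) => [a -> | a ->].
- rewrite -[RHS](ann_quad a (lshift d 0)).
  by apply: eq_bigr => i _; rewrite mxE col_mxEu Hmx0 mulr1.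
- rewrite -[RHS]ann_sqform.
  by apply: eq_bigr => i _; rewrite mxE col_mxEd mxE.
Qed.

Lemma ann_sub_Hmx (alpha beta : K) :
  uniq s -> alpha != 0 -> beta != 0 -> two_distance_set [in s] alpha beta ->
  (u <= Hmx s)%MS.
Proof.
move=> s_uniq a0 b0 [_ hS].
pose c := \sum_i u 0 i * sqform (tnth s i) ^+ 2.
pose w k := \sum_i u 0 i * sqform (tnth s i) * tnth s i 0 k.
have ab0 : alpha * beta != 0 by rewrite mulf_neq0.
have key j : alpha * beta * u 0 j = c - 4 * \sum_k w k * tnth s j 0 k.
  transitivity (\sum_i u 0 i * ((sqform (tnth s i - tnth s j) - alpha)
                               * (sqform (tnth s i - tnth s j) - beta))).
    rewrite (bigD1 j) //= subrr sqform0 big1 ?addr0; first by ring.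
    move=> i neq_ij.
    have [] : sqform (tnth s i - tnth s j) = alpha
              \/ sqform (tnth s i - tnth s j) = beta.
      apply/hS; exists (tnth s i), (tnth s j); split=> //; try exact: mem_tnth.
      by apply: contraNneq neq_ij => /tuple_uniqP ->.
    - by move=> ->; rewrite subrr mul0r mulr0.
    - by move=> ->; rewrite subrr !mulr0.
  rewrite ann_quartic; congr (_ - 4 * _).
  under eq_bigr do rewrite mulr_sumr.
  rewrite exchange_big; apply: eq_bigr => k _ /=.
  by rewrite /w mulr_suml; apply: eq_bigr => i _; rewrite mulrA.
apply/submxP.
(* Coefficients of the affine function in [key]: [c] pairs with the row of ones, [- 4 * w k] with
   the k-th coordinates. *)
exists ((alpha * beta)^-1 *: row_mx c%:M (\row_k (- 4 * w k))).
rewrite -scalemxAl mul_row_col mul_scalar_mx.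
apply/rowP => j; apply: (mulfI ab0); rewrite key !mxE mulVKf //.
rewrite mulr1 mulr_sumr -sumrN; congr (_ + _).
by apply: eq_bigr => k _; rewrite !mxE; ring.
Qed.

End Annihilator.

(** The left kernel of [(quadmx s)^T] has dimension [m - \rank (quadmx s)]; it lies in the part of
    the row space of H killed by Hhat^T, of dimension rank H - rank (H Hhat^T). *)
Lemma rank_quadmx_ge s (alpha beta : K) :
  uniq s -> alpha != 0 -> beta != 0 -> two_distance_set [in s] alpha beta ->
  (m + \rank (Hmx s *m (Hhatmx s)^T) <= \rank (quadmx s) + \rank (Hmx s))%N.
Proof.
move=> s_uniq a0 b0 hS.
have sub : (kermx (quadmx s)^T <= Hmx s :&: kermx (Hhatmx s)^T)%MS.
  apply/row_subP => i.
  have ui : row i (kermx (quadmx s)^T) *m (quadmx s)^T = 0.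
    by apply/sub_kermxP; apply: row_sub.
  rewrite sub_capmx (ann_sub_Hmx ui s_uniq a0 b0 hS) /=.
  by apply/sub_kermxP; apply: ann_Hhatmx.
have := mxrankS sub; rewrite mxrank_ker mxrank_tr.
have := mxrank_mul_ker (Hmx s) (Hhatmx s)^T.
by lia.
Qed.

Lemma rank_quadmx_lt_bin s :
  (0 < d)%N -> (\row_i sqform (tnth s i) <= Hmx s)%MS ->
  (\rank (quadmx s) < 'C(d + 2, 2))%N.
Proof.
move=> d_gt0 /submxP[w wE].
rewrite ltn_neqAle -card_le_pair rank_leq_row andbT.
apply/negP => free.
(* coefficients of the polynomial Q(x) - w (1, x)^T *)
pose c : 'rV[K]_#|{: le_pair}| := \row_t
  (let p := val (enum_val t) in
   if p.1 == lshift d 0 then - w 0 p.2 else (p.1 == p.2)%:R).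
suff cP : c *m quadmx s = 0.
  (* The coefficient of the square of the first coordinate is 1, so [c] would be a nontrivial
     relation between the rows of [quadmx s]. *)
  pose k := Ordinal d_gt0.
  pose t : le_pair := exist _ (rshift 1 k, rshift 1 k) (leqnn _).
  have /rowP/(_ (enum_rank t)) := row_free_inj free (etrans cP (esym (mul0mx _ _))).
  by rewrite !mxE enum_rankK /= => /eqP; rewrite oner_eq0.
apply/rowP => i; rewrite !mxE.
pose F (p : 'I_(1 + d) * 'I_(1 + d)) : K :=
  (if p.1 == lshift d 0 then - w 0 p.2 else (p.1 == p.2)%:R)
  * (Hmx s p.1 i * Hmx s p.2 i).
transitivity (\sum_(p : 'I_(1 + d) * 'I_(1 + d) | (p.1 <= p.2)%N) F p).
  rewrite (reindex_omap (val : le_pair -> _) insub) /=; last first.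
    by move=> p le_p; rewrite insubT.
  rewrite [RHS](eq_bigl xpredT); last by move=> p; rewrite (valP p) valK eqxx.
  rewrite [RHS](reindex (enum_val : 'I_#|{: le_pair}| -> le_pair)) /=; last first.
    exact: onW_bij (enum_val_bij _).
  by apply: eq_bigr => t _; rewrite [c _ _]mxE [quadmx s _ _]mxE.
rewrite -(pair_big_dep xpredT (fun a b : 'I_(1 + d) => (a <= b)%N)
           (fun a b => F (a, b))) /=.
(* The pairs starting with 0 form the affine part and sum to -Q(s_i); among the others only the
   squares survive, and they sum to Q(s_i). *)
rewrite big_split_ord /= big_ord1.
have := congr1 (fun v : 'rV_m => v 0 i) wE; rewrite !mxE => wi.
have -> : \sum_(b : 'I_(1 + d) | (lshift d (@ord0 0) <= b)%N) F (lshift d 0, b)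
          = - sqform (tnth s i).
  rewrite wi -sumrN; apply: eq_big => // b _.
  by rewrite /F /= Hmx0 mul1r mulNr.
rewrite addrC /sqform -sumrB big1 // => k _.
rewrite (bigD1 (rshift 1 k)) //= big1 ?addr0.
  by rewrite /F /= eqxx HmxS mul1r -expr2 subrr.
move=> b /andP[_ /negPf b_neq].
by rewrite /F /= eq_sym b_neq mul0r.
Qed.

(** Either the row of values of Q lies in the row space of H, and [quadmx s] loses rank, or
    adjoining it makes rank Hhat exceed rank H. *)
Lemma rank_quadmx_lt s :
  (0 < d)%N ->
  (\rank (quadmx s) + \rank (Hmx s) < 'C(d + 2, 2) + \rank (Hhatmx s))%N.
Proof.
move=> d_gt0; set q := \row_(i < m) sqform (tnth s i).
have leH : (Hmx s <= Hhatmx s)%MS by rewrite /Hhatmx -addsmxE addsmxSl.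
have leP : (\rank (quadmx s) <= 'C(d + 2, 2))%N by rewrite -card_le_pair rank_leq_row.
have [q_sub | q_nsub] := boolP (q <= Hmx s)%MS.
  by have := rank_quadmx_lt_bin d_gt0 q_sub; have := mxrankS leH; lia.
suff: (Hmx s < Hhatmx s)%MS by move/rank_ltmx; lia.
rewrite /ltmx leH; apply: contra q_nsub; apply: submx_trans.
by rewrite /Hhatmx -addsmxE addsmxSr.
Qed.

(** The value [alpha] is attained at two distinct points, whereas K^0 has only one. *)
Lemma two_distance_dim_gt0 (S : {pred 'rV[K]_d}) (alpha beta : K) :
  two_distance_set S alpha beta -> (0 < d)%N.
Proof.
case=> _ /(_ alpha)[_ /(_ (or_introl erefl))[x [y [_ _ neq_xy _]]]].
rewrite lt0n; apply: contraNneq neq_xy => d0; apply/eqP/rowP => k.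
by case: k => k lt_kd; exfalso; rewrite d0 in lt_kd.
Qed.

End TwoDistance.

Theorem theorem2p2 (K : fieldType) (hK : 2%N \notin [pchar K])
    (d m : nat) (s : m.-tuple 'rV[K]_d) (hs : uniq s)
    (alpha beta : K) (halpha : alpha != 0) (hbeta : beta != 0)
    (hS : two_distance_set [in s] alpha beta) :
  [/\ m%:Z <= 'C(d + 2, 2)%:Z - 1 + (\rank (Hhatmx s))%:Z
              - (\rank (Hmx s *m (Hhatmx s)^T))%:Z,
      m%:Z <= 'C(d + 2, 2)%:Z + (\rank (Hmx s))%:Z
              - (\rank (Hmx s *m (Hmx s)^T))%:Z
    & m%:Z <= 'C(d + 2, 2)%:Z + d%:Z + 1
              - (\rank (Hmx s *m (Hmx s)^T))%:Z].
Proof.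
have ge := rank_quadmx_ge hs halpha hbeta hS.
have le := rank_quadmx_lt s (two_distance_dim_gt0 hS).
(* The single adjoined row absorbs the -1 of the first bound. *)
have leHhat : (\rank (Hhatmx s) <= \rank (Hmx s) + 1)%N.
  rewrite /Hhatmx -addsmxE; apply: leq_trans (mxrank_adds_leqif _ _) _.
  by rewrite leq_add2l rank_leq_row.
have leHH : (\rank (Hmx s *m (Hmx s)^T) <= \rank (Hmx s *m (Hhatmx s)^T))%N.
  rewrite -mxrank_tr -[leqRHS]mxrank_tr !trmx_mul !trmxK /Hhatmx (mul_col_mx (Hmx s)).
  by apply: mxrankS; rewrite /Hhatmx -addsmxE addsmxSl.
have leH : (\rank (Hmx s) <= 1 + d)%N := rank_leq_row _.
by split; lia.
Qed.
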